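(* The Lagrange inversion formula is not true in the $C^\infty$ category. That is, there exists a real-valued $C^\infty$ function $h$ on an open interval containing $0$, with $h(0)=0$ and $|h'(0)|<1$, such that, if $y=y(x)$ denotes the continuous solution, on a neighborhood of $0$, of $y(x)=x+h(y(x))$ with $y(0)=0$, then there is no neighborhood of $0$ on which the formula $$ y(x) = x + \sum_{n=1}^\infty \frac{1}{n!}\left(\frac{d}{dx}\right)^{n-1}\left\{h(x)^n\right\} $$ holds at every point $x$ (that is, in every neighborhood of $0$ there is a point $x$ at which the series either fails to converge or has a sum such that the equality fails).
   Context: In the formula, $h(x)^n$ is the $n$-th power of $h(x)$ (not an iterate), and $\left(\frac{d}{dx}\right)^{n-1}\{h(x)^n\}$ is the $(n-1)$-th derivative of the function $x\mapsto h(x)^n$. The existence and uniqueness of the continuous local solution $y$ near $0$ follow from the implicit function theorem since $h'(0)\neq 1$. *)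

(* Defs.v *)
From Stdlib Require Import Arith Reals.
From Coquelicot Require Import Coquelicot.
Open Scope R_scope.

(* Extended endpoints, so that unbounded open intervals are included. *)
Definition in_open_interval (a b : Rbar) (x : R) : Prop :=
  Rbar_lt a (Finite x) /\ Rbar_lt (Finite x) b.

Definition smooth_on (a b : Rbar) (h : R -> R) : Prop :=
  forall (n : nat) (x : R), in_open_interval a b x -> ex_derive_n h n x.

(* [h] is a function on the interval (a, b) only: as a term it is total, so a
   solution has to take its values in (a, b) for [h (y x)] to be meaningful. *)
Definition local_continuous_solution
    (a b : Rbar) (h : R -> R) (y : R -> R) : Prop :=
  y 0 = 0 /\
  locally 0 (fun x : R =>
    continuous y x /\ in_open_interval a b (y x) /\ y x = x + h (y x)).

(* Meant for n >= 1. The value at x depends only on the germ of [h] at x, hence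
   not on the values of [h] outside an open interval containing x. *)
Definition lagrange_term (h : R -> R) (n : nat) (x : R) : R :=
  / INR (fact n) * Derive_n (fun t : R => h t ^ n) (n - 1) x.

(* The series over n >= 1 is reindexed by n = k + 1. *)
Definition lagrange_formula_at (h y : R -> R) (x : R) : Prop :=
  exists s : R,
    is_series (fun k : nat => lagrange_term h (S k) x) s /\ y x = x + s.

(* Main.v *)
Require Import Defs.
From Stdlib Require Import Arith Reals Lra Lia Classical_Pred_Type.
From Coquelicot Require Import Coquelicot.
Open Scope R_scope.

(** Let [h] be smooth and strictly increasing with [h 0 = 0].  At a point [x > 0]
    where all derivatives of [h] of order at least 1 vanish, every term of the
    series with n >= 2 vanishes, so the formula reads [y x = x + h x]; with
    [y x = x + h (y x)] it gives [h (x + h x) = h x], which contradicts strict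
    monotonicity since [h x > 0].  Such points accumulate at 0 for the primitive
    [h] of [exp (- / s ^ 2) / 2], where [s t = exp (- / t ^ 2) * sin (/ t)]. *)

(** * Calculus of functions whose derivatives vanish on a set *)

(* [f] is [n] times differentiable, and its derivatives of order at most [n]
   vanish on [Z]; with [Z] empty this is plain [n]-fold differentiability. *)
Fixpoint flat (Z : R -> Prop) (n : nat) (f : R -> R) : Prop :=
  (forall x, Z x -> f x = 0) /\
  match n with
  | O => True
  | S m => exists f' : R -> R, (forall x, is_derive f x (f' x)) /\ flat Z m f'
  end.

Definition differentiable (n : nat) (f : R -> R) : Prop := flat (fun _ => False) n f.

Lemma flat_subset (Z Z' : R -> Prop) n : (forall x, Z' x -> Z x) ->
  forall f, flat Z n f -> flat Z' n f.
Proof.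
  intros HZ; induction n as [|n IH]; intros f [H0 H]; split; auto.
  destruct H as [f' [Hd Hf']]; exists f'; auto.
Qed.

Lemma flat_differentiable Z n f : flat Z n f -> differentiable n f.
Proof. apply flat_subset; tauto. Qed.

Lemma flat_pred Z n : forall f, flat Z (S n) f -> flat Z n f.
Proof.
  induction n as [|n IH]; intros f [H0 [f' [Hd Hf']]]; split; auto.
  exists f'; auto.
Qed.

Lemma flat_plus Z n : forall f g,
  flat Z n f -> flat Z n g -> flat Z n (fun x => f x + g x).
Proof.
  induction n as [|n IH]; intros f g [F0 F] [G0 G]; split; auto;
    try (intros x Hx; rewrite F0, G0 by auto; ring).
  destruct F as [f' [Fd F]], G as [g' [Gd G]].
  exists (fun x => f' x + g' x); split; auto.
  intros x; exact (is_derive_plus f g x _ _ (Fd x) (Gd x)).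
Qed.

Lemma flat_scal Z c n : forall f, flat Z n f -> flat Z n (fun x => c * f x).
Proof.
  induction n as [|n IH]; intros f [F0 F]; split; auto;
    try (intros x Hx; rewrite F0 by auto; ring).
  destruct F as [f' [Fd F]].
  exists (fun x => c * f' x); split; auto.
  intros x; exact (is_derive_scal f x c _ (Fd x)).
Qed.

Lemma differentiable_const c n : differentiable n (fun _ => c).
Proof.
  revert c; induction n as [|n IH]; intros c; split; try tauto.
  exists (fun _ => 0); split; [|apply IH].
  intros x; exact (is_derive_const c x).
Qed.

(** By Leibniz, the derivative is [f' * g + f * g'], and each summand keeps a flat factor; mere
    differentiability of the other factor suffices. *)
Lemma flat_mult Z n : forall f g,
  flat Z n f -> differentiable n g -> flat Z n (fun x => f x * g x).
Proof.
  induction n as [|n IH]; intros f g Ff Gg.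
  - destruct Ff as [F0 _]; split; auto.
    intros x Hx; rewrite F0 by auto; ring.
  - pose proof (flat_pred _ _ _ Ff) as Ff1; pose proof (flat_pred _ _ _ Gg) as Gg1.
    destruct Ff as [F0 [f' [Fd F]]], Gg as [_ [g' [Gd G]]].
    split; [intros x Hx; rewrite F0 by auto; ring|].
    exists (fun x => f' x * g x + f x * g' x); split.
    + intros x. apply (is_derive_mult f g x _ _ (Fd x) (Gd x)).
      intros a b; apply Rmult_comm.
    + apply flat_plus; auto.
Qed.

Lemma differentiable_pow n m f : differentiable n f -> differentiable n (fun x => f x ^ m).
Proof.
  intros Hf; induction m as [|m IH]; simpl.
  - apply differentiable_const.
  - apply flat_mult; auto.
Qed.

(** In the chain rule [f' (s x) * s' x] the first factor is flat by induction and the second is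
    differentiable, so [flat_mult] applies. *)
Lemma flat_comp Z s n : forall f,
  flat Z n f -> differentiable n s -> flat (fun x => Z (s x)) n (fun x => f (s x)).
Proof.
  induction n as [|n IH]; intros f Ff Ss.
  - destruct Ff as [F0 _]; split; auto.
  - pose proof (flat_pred _ _ _ Ss) as Ss1.
    destruct Ff as [F0 [f' [Fd F]]], Ss as [_ [s' [Sd S]]].
    split; [auto|].
    exists (fun x => f' (s x) * s' x); split.
    + intros x. rewrite Rmult_comm. exact (is_derive_comp f s x _ _ (Fd (s x)) (Sd x)).
    + apply flat_mult; auto.
Qed.

Lemma Derive_n_S_is_derive f f' n x :
  (forall t, is_derive f t (f' t)) -> Derive_n f (S n) x = Derive_n f' n x.
Proof.
  intros Hd. rewrite <- Nat.add_1_r, <- Derive_n_comp.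
  apply Derive_n_ext; intros t; apply is_derive_unique, Hd.
Qed.

Lemma flat_Derive_n Z n : forall f x, flat Z n f -> Z x -> Derive_n f n x = 0.
Proof.
  induction n as [|n IH]; intros f x [F0 F] Hx; [exact (F0 x Hx)|].
  destruct F as [f' [Fd F]].
  rewrite (Derive_n_S_is_derive f f') by auto; auto.
Qed.

Lemma differentiable_ex_derive_n n : forall f x, differentiable n f -> ex_derive_n f n x.
Proof.
  induction n as [|n IH]; intros f x [_ F]; [exact I|].
  destruct F as [f' [Fd F]].
  (* Order 1 is separate: there the induction hypothesis concerns order 0, where [ex_derive_n] is
     just [True]. *)
  destruct n as [|n]; [exists (f' x); apply Fd|].
  apply ex_derive_ext with (Derive_n f' n).
  - intros t; symmetry; apply Derive_n_S_is_derive, Fd.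
  - exact (IH f' x F).
Qed.

(** * Oscillating functions that are flat at 0 *)

(* This family is closed under differentiation, up to linear combinations; the
   phase [b] covers sines, cosines and (with [a = 0]) constants at once. *)
Definition wave (k : nat) (a b u : R) : R :=
  if Req_EM_T u 0 then 0 else (/ u) ^ k * exp (- (/ u) ^ 2) * sin (a * / u + b).

Lemma wave_0 k a b : wave k a b 0 = 0.
Proof. unfold wave; destruct (Req_EM_T 0 0); lra. Qed.

Lemma wave_neq k a b u : u <> 0 ->
  wave k a b u = (/ u) ^ k * exp (- (/ u) ^ 2) * sin (a * / u + b).
Proof. intros H; unfold wave; destruct (Req_EM_T u 0); [contradiction|reflexivity]. Qed.

Lemma exp_le_compat x y : x <= y -> exp x <= exp y.
Proof. intros [H| ->]; [left; apply exp_increasing, H|right; reflexivity]. Qed.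

Lemma exp_pow x n : exp x ^ n = exp (INR n * x).
Proof.
  induction n as [|n IH]; [simpl; rewrite Rmult_0_l, exp_0; reflexivity|].
  rewrite S_INR, Rmult_plus_distr_r, Rmult_1_l, exp_plus; simpl; rewrite IH; ring.
Qed.

(** With [M = m + 1], the bound [1 + t <= exp t] gives [|v| <= M + v^2 <= M * exp (v^2 / M)]; the
    [m]-th power is at most [M^m * exp (v^2)] because [m / M <= 1]. *)
Lemma pow_exp_bounded (m : nat) :
  exists C, 0 <= C /\ forall v, Rabs (v ^ m) * exp (- v ^ 2) <= C.
Proof.
  set (M := INR (S m)).
  assert (HM : 1 <= M) by (unfold M; rewrite S_INR; generalize (pos_INR m); lra).
  exists (M ^ m); split; [apply pow_le; lra|]; intros v.
  assert (Hv : Rabs v <= M * exp (v ^ 2 / M)).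
  { assert (H1 : 1 + v ^ 2 / M <= exp (v ^ 2 / M)) by apply exp_ineq1_le.
    assert (H2 : M * (1 + v ^ 2 / M) <= M * exp (v ^ 2 / M))
      by (apply Rmult_le_compat_l; lra).
    replace (M * (1 + v ^ 2 / M)) with (M + v ^ 2) in H2 by (field; lra).
    pose proof (pow2_abs v) as H3.
    pose proof (Rabs_pos v). nra. }
  assert (He : exp (v ^ 2 / M) ^ m <= exp (v ^ 2)).
  { rewrite exp_pow. apply exp_le_compat.
    replace (INR m * (v ^ 2 / M)) with ((M - 1) / M * v ^ 2)
      by (unfold M; rewrite S_INR; field; rewrite <- S_INR; fold M; lra).
    assert (0 < / M) by (apply Rinv_0_lt_compat; lra).
    replace ((M - 1) / M) with (1 - / M) by (field; lra).
    pose proof (pow2_ge_0 v). nra. }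
  rewrite exp_Ropp. apply Rle_div_l; [apply exp_pos|].
  rewrite <- RPow_abs.
  apply Rle_trans with ((M * exp (v ^ 2 / M)) ^ m).
  - apply pow_incr; split; [apply Rabs_pos|exact Hv].
  - rewrite Rpow_mult_distr. apply Rmult_le_compat_l; [apply pow_le; lra|exact He].
Qed.

(** The previous bound is used at [/ u] with exponent [k + 2]: the two extra powers of [/ u] become
    the factor [u ^ 2]. *)
Lemma wave_quadratic k a b : exists C, 0 <= C /\ forall u, Rabs (wave k a b u) <= C * u ^ 2.
Proof.
  destruct (pow_exp_bounded (k + 2)) as [C [HC H]].
  exists C; split; [exact HC|]; intros u.
  destruct (Req_dec u 0) as [->|Hu]; [rewrite wave_0, Rabs_R0; lra|].
  rewrite wave_neq by exact Hu.
  specialize (H (/ u)).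
  rewrite !Rabs_mult, (Rabs_pos_eq (exp _)) by (left; apply exp_pos).
  set (E := exp _) in *.
  rewrite pow_add, Rabs_mult, (Rabs_pos_eq ((/ u) ^ 2)), pow_inv in H
    by apply pow2_ge_0.
  assert (Hu2 : 0 < u ^ 2) by (apply pow2_gt_0; exact Hu).
  assert (HE : 0 <= Rabs ((/ u) ^ k) * E)
    by (apply Rmult_le_pos; [apply Rabs_pos|left; apply exp_pos]).
  assert (Hs : Rabs (sin (a * / u + b)) <= 1)
    by (apply Rabs_le; generalize (SIN_bound (a * / u + b)); lra).
  apply Rle_trans with (Rabs ((/ u) ^ k) * E); [nra|].
  rewrite pow_inv.
  apply (Rmult_le_compat_r (u ^ 2)) in H; [|lra].
  refine (Rle_trans _ _ _ _ H); right; field; exact Hu.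
Qed.

Lemma is_derive_quadratic_0 (f : R -> R) C : 0 <= C ->
  (forall u, Rabs (f u) <= C * u ^ 2) -> is_derive f 0 0.
Proof.
  intros HC H. apply is_derive_Reals. intros eps Heps.
  assert (H0 : f 0 = 0).
  { specialize (H 0). replace (C * 0 ^ 2) with 0 in H by ring.
    apply Rabs_eq_0, Rle_antisym; [exact H|apply Rabs_pos]. }
  (* The difference quotient at 0 is at most [C * |u|]; dividing by [C + 1] also covers [C = 0]. *)
  assert (Hd : 0 < eps / (C + 1)) by (apply Rdiv_lt_0_compat; lra).
  exists (mkposreal _ Hd); simpl; intros u Hu Hsmall.
  rewrite Rplus_0_l, H0, !Rminus_0_r.
  assert (Hup : 0 < Rabs u) by (apply Rabs_pos_lt; exact Hu).
  unfold Rdiv; rewrite Rabs_mult, Rabs_inv.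
  apply Rlt_div_r in Hsmall; [|lra].
  apply Rlt_div_l; [exact Hup|].
  specialize (H u). rewrite <- pow2_abs in H. nra.
Qed.

(** Away from 0 the three terms come from the power, the exponential and the sine, with the cosine
    written as a sine of phase shifted by [PI / 2]. At 0 every wave vanishes and the quadratic bound
    gives derivative 0. *)
Lemma is_derive_wave k a b u : is_derive (wave k a b) u
  (- INR k * wave (k + 1) a b u
   + (2 * wave (k + 3) a b u + - a * wave (k + 2) a (b + PI / 2) u)).
Proof.
  destruct (Req_dec u 0) as [->|Hu].
  - rewrite !wave_0. replace (- INR k * 0 + (2 * 0 + - a * 0)) with 0 by ring.
    destruct (wave_quadratic k a b) as [C [HC H]].
    exact (is_derive_quadratic_0 _ C HC H).
  - rewrite !wave_neq by exact Hu.
    apply is_derive_ext_loc with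
      (fun u => (/ u) ^ k * exp (- (/ u) ^ 2) * sin (a * / u + b)).
    + assert (Hp : 0 < Rabs u) by (apply Rabs_pos_lt; exact Hu).
      exists (mkposreal _ Hp); intros t Ht; symmetry; apply wave_neq.
      intros ->. change (Rabs (0 - u) < Rabs u) in Ht.
      rewrite Rminus_0_l, Rabs_Ropp in Ht; lra.
    + auto_derive; [repeat split; exact Hu|].
      replace (a * / u + (b + PI / 2)) with (PI / 2 + (a * / u + b)) by ring.
      rewrite <- cos_sin.
      destruct k as [|k]; simpl Nat.pred; rewrite ?pow_add; simpl; field; exact Hu.
Qed.

Lemma flat_wave n : forall k a b, flat (fun u => u = 0) n (wave k a b).
Proof.
  induction n as [|n IH]; intros k a b.
  - split; [intros u ->; apply wave_0|exact I].
  - split; [intros u ->; apply wave_0|].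
    eexists; split; [intros u; apply is_derive_wave|].
    repeat apply flat_plus; apply flat_scal; apply IH.
Qed.

(** Otherwise [sin (/ t)] would vanish on the interval away from 0, hence so would its derivative
    [- cos (/ t) / t^2]; but sine and cosine have no common zero. *)
Lemma ex_wave_neq_0 u v : u < v -> exists t, u < t < v /\ wave 0 1 0 t <> 0.
Proof.
  intros Huv. apply not_all_not_ex. intros N.
  assert (Hs : forall t, u < t < v -> t <> 0 -> sin (/ t) = 0).
  { intros t Ht Ht0. destruct (Req_dec (wave 0 1 0 t) 0) as [E|E].
    - rewrite wave_neq in E by exact Ht0.
      rewrite pow_O, !Rmult_1_l, Rplus_0_r in E.
      apply Rmult_integral in E as [E|E]; [|exact E].
      generalize (exp_pos (- (/ t) ^ 2)); lra.
    - exfalso; apply (N t); auto. }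
  assert (Ht : exists t, u < t < v /\ t <> 0).
  { destruct (Req_dec ((u + v) / 2) 0).
    - exists ((u + 2 * v) / 3); split; lra.
    - exists ((u + v) / 2); split; lra. }
  destruct Ht as [t [Ht Ht0]].
  assert (D1 : is_derive (fun t => sin (/ t)) t (- / t ^ 2 * cos (/ t))).
  { auto_derive; [exact Ht0|]. field; exact Ht0. }
  assert (D2 : is_derive (fun t => sin (/ t)) t 0).
  { apply is_derive_ext_loc with (fun _ => 0); [|apply @is_derive_const].
    assert (Hp : 0 < Rmin (Rabs t) (Rmin (t - u) (v - t)))
      by (repeat apply Rmin_pos; try lra; apply Rabs_pos_lt, Ht0).
    exists (mkposreal _ Hp); intros w Hw.
    change (Rabs (w - t) < Rmin (Rabs t) (Rmin (t - u) (v - t))) in Hw.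
    apply Rmin_Rgt_l in Hw as [Hw1 Hw]; apply Rmin_Rgt_l in Hw as [Hw2 Hw3].
    apply Rabs_lt_between in Hw2, Hw3.
    symmetry; apply Hs; [lra|].
    intros ->; rewrite Rminus_0_l, Rabs_Ropp in Hw1; lra. }
  apply is_derive_unique in D1, D2. rewrite D1 in D2.
  apply Rmult_integral in D2 as [D2|D2].
  - assert (0 < / t ^ 2) by (apply Rinv_0_lt_compat, pow2_gt_0, Ht0); lra.
  - generalize (sin2_cos2 (/ t)); rewrite D2, (Hs t Ht Ht0); unfold Rsqr; lra.
Qed.

(** * Monotonicity and the solution of the implicit equation *)

Lemma MVT_derive (f f' : R -> R) u v : (forall x, is_derive f x (f' x)) ->
  exists c, f v - f u = f' c * (v - u).
Proof.
  intros Hd. destruct (MVT_gen f u v f') as [c [_ Hc]]; [auto| |exists c; exact Hc].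
  intros x _. apply continuity_pt_filterlim, @ex_derive_continuous.
  exists (f' x); apply Hd.
Qed.

(** [f] is nondecreasing, so [f u = f v] would make it constant on the interval, forcing [f'] to
    vanish throughout its interior. *)
Lemma strictly_increasing_derive (f f' : R -> R) :
  (forall x, is_derive f x (f' x)) -> (forall x, 0 <= f' x) ->
  (forall u v, u < v -> exists t, u < t < v /\ f' t <> 0) ->
  forall u v, u < v -> f u < f v.
Proof.
  intros Hd Hpos Hne u v Huv.
  assert (mono : forall x y, x <= y -> f x <= f y).
  { intros x y Hxy. destruct (MVT_derive f f' x y Hd) as [c Hc].
    specialize (Hpos c). nra. }
  destruct (Rle_lt_or_eq_dec (f u) (f v) (mono u v (Rlt_le _ _ Huv))) as [|E]; [assumption|].
  destruct (Hne u v Huv) as [t [Ht Hf]]; contradict Hf.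
  rewrite <- (is_derive_unique _ _ _ (Hd t)). apply is_derive_unique.
  apply is_derive_ext_loc with (fun _ => f u); [|apply @is_derive_const].
  assert (Hp : 0 < Rmin (t - u) (v - t)) by (apply Rmin_pos; lra).
  exists (mkposreal _ Hp); intros w Hw.
  change (Rabs (w - t) < Rmin (t - u) (v - t)) in Hw.
  apply Rmin_Rgt_l in Hw as [Hw1 Hw2]; apply Rabs_lt_between in Hw1, Hw2.
  assert (f u <= f w) by (apply mono; lra).
  assert (f w <= f v) by (apply mono; lra). lra.
Qed.

(** The map [y - h y] grows with slope at least 1/2, so it is a bijection of the line and its
    inverse is 2-Lipschitz. *)
Lemma continuous_fixpoint (h h' : R -> R) : h 0 = 0 ->
  (forall x, is_derive h x (h' x)) -> (forall x, h' x <= 1 / 2) ->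
  exists y : R -> R, y 0 = 0 /\ forall x, continuous y x /\ y x = x + h (y x).
Proof.
  intros H0 Hd Hle.
  assert (grow : forall u v, u <= v -> (v - u) / 2 <= (v - h v) - (u - h u)).
  { intros u v Huv. destruct (MVT_derive h h' u v Hd) as [c Hc].
    specialize (Hle c). nra. }
  (* A sigma type, so that [proj1_sig] defines the solution without a choice axiom. *)
  assert (sol : forall x, {y | y = x + h y}).
  { intros x.
    (* Since [h 0 = 0], [grow] makes [y - h y] at least [|x|] at [2 * |x|] and at most [- |x|] at
       [- (2 * |x|)]. *)
    destruct (IVT_cor (fun y => y - h y - x) (- (2 * Rabs x)) (2 * Rabs x)) as [y [_ Hy]].
    - intros y. apply continuity_pt_filterlim, (ex_derive_continuous (fun y => y - h y - x)).
      auto_derive. exists (h' y); apply Hd.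
    - generalize (Rabs_pos x); lra.
    - pose proof (Rabs_pos x).
      assert (G1 := grow 0 (2 * Rabs x) ltac:(lra)).
      assert (G2 := grow (- (2 * Rabs x)) 0 ltac:(lra)).
      assert (B := Rle_abs x). assert (B' := Rle_abs (- x)). rewrite Rabs_Ropp in B'.
      rewrite H0 in G1, G2. nra.
    - exists y; lra. }
  exists (fun x => proj1_sig (sol x)).
  assert (lip : forall x z,
    Rabs (proj1_sig (sol z) - proj1_sig (sol x)) <= 2 * Rabs (z - x)).
  { intros x z.
    destruct (sol x) as [u Hu], (sol z) as [v Hv]; simpl.
    destruct (Rle_dec u v) as [L|L].
    - assert (G := grow u v L). rewrite (Rabs_pos_eq (v - u)) by lra.
      generalize (Rle_abs (z - x)); lra.
    - assert (G := grow v u ltac:(lra)).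
      rewrite (Rabs_left1 (v - u)), (Rabs_minus_sym z x) by lra.
      generalize (Rle_abs (x - z)); lra. }
  split.
  - destruct (sol 0) as [u Hu]; simpl.
    destruct (Rle_dec 0 u) as [L|L].
    + assert (G := grow 0 u L); lra.
    + assert (G := grow u 0 ltac:(lra)); lra.
  - intros x; split; [|exact (proj2_sig (sol x))].
    apply filterlim_locally; intros eps.
    assert (He : 0 < eps / 2) by (generalize (cond_pos eps); lra).
    exists (mkposreal _ He); intros z Hz.
    change (Rabs (z - x) < eps / 2) in Hz.
    change (Rabs (proj1_sig (sol z) - proj1_sig (sol x)) < eps).
    specialize (lip x z); lra.
Qed.

(** * The Lagrange series at a flat point *)

(** The first derivative of [h ^ m] already contains the flat factor [h'], and further
    differentiation preserves flatness. *)
Lemma Derive_n_pow_flat (Z : R -> Prop) (h h' : R -> R) :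
  (forall x, is_derive h x (h' x)) -> (forall n, flat Z n h') ->
  forall m j x, Z x -> Derive_n (fun t => h t ^ m) (S j) x = 0.
Proof.
  intros Hd Hf m j x Hx.
  assert (Hh : differentiable j h).
  { apply (flat_pred _ j); split; [tauto|].
    exists h'; split; [exact Hd|apply flat_differentiable with Z, Hf]. }
  rewrite (Derive_n_S_is_derive _ (fun t => h' t * (INR m * h t ^ (Nat.pred m)))).
  - apply flat_Derive_n with Z; [|exact Hx].
    apply flat_mult; [apply Hf|].
    apply flat_scal, differentiable_pow, Hh.
  - intros t. evar_last; [exact (is_derive_pow h m t _ (Hd t))|ring].
Qed.

Lemma lagrange_formula_flat h y x :
  (forall m j, Derive_n (fun t => h t ^ m) (S j) x = 0) ->
  lagrange_formula_at h y x -> y x = x + h x.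
Proof.
  intros Hz [s [Hs ->]]. f_equal. symmetry.
  apply filterlim_locally_unique with (2 := Hs).
  (* Index 0 is the term n = 1, equal to [h x]; later terms involve derivatives of positive order.
     Hence every partial sum is [h x]. *)
  apply filterlim_ext with (fun _ => h x); [|apply filterlim_const].
  intros n; induction n as [|n IH].
  - rewrite sum_O; unfold lagrange_term; simpl. field.
  - rewrite sum_Sn, <- IH; unfold lagrange_term.
    replace (S (S n) - 1)%nat with (S n) by lia.
    rewrite Hz, Rmult_0_r. symmetry; apply Rplus_0_r.
Qed.

(** * Flat points near 0 and the counterexample *)

Lemma ex_wave_zero (eps : posreal) : exists x, 0 < x < eps /\ wave 0 1 0 x = 0.
Proof.
  (* The zero is [/ (N * PI)] with [/ N < eps]; it is below [eps] because [PI > 1]. *)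
  destruct (archimed_cor1 eps (cond_pos eps)) as [N [HN HN0]].
  assert (HNpos : 0 < INR N) by (apply lt_0_INR; lia).
  assert (Hx : 0 < / (INR N * PI))
    by (apply Rinv_0_lt_compat, Rmult_lt_0_compat; [exact HNpos|apply PI_RGT_0]).
  exists (/ (INR N * PI)); split; [split; [exact Hx|]|].
  - refine (Rle_lt_trans _ _ _ _ HN). apply Rinv_le_contravar; [exact HNpos|].
    generalize PI2_1; nra.
  - rewrite wave_neq, Rinv_inv by lra.
    replace (1 * (INR N * PI) + 0) with (IZR (Z.of_nat N) * PI)
      by (rewrite <- INR_IZR_INZ; ring).
    rewrite (sin_eq_0_1 (IZR (Z.of_nat N) * PI)); [ring|].
    exists (Z.of_nat N); reflexivity.
Qed.

(* The constant PI / 6 makes [wave 0 0 (PI / 6)] equal to [exp (- / u ^ 2) / 2]. *)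
Definition slope (t : R) : R := wave 0 0 (PI / 6) (wave 0 1 0 t).

(** The outer wave is flat at 0, so composition makes every zero of the inner wave, and not only the
    origin, a flat point. *)
Lemma flat_slope n : flat (fun t => wave 0 1 0 t = 0) n slope.
Proof.
  apply (flat_comp (fun u => u = 0) (wave 0 1 0)); [apply flat_wave|].
  apply flat_differentiable with (fun u => u = 0), flat_wave.
Qed.

Lemma slope_pos t : wave 0 1 0 t <> 0 -> 0 < slope t <= 1 / 2.
Proof.
  intros H; unfold slope. rewrite wave_neq by exact H.
  rewrite Rmult_0_l, Rplus_0_l, sin_PI6, pow_O, Rmult_1_l.
  set (v := / _).
  assert (exp (- v ^ 2) <= exp 0)
    by (apply exp_le_compat; generalize (pow2_ge_0 v); lra).
  rewrite exp_0 in *. generalize (exp_pos (- v ^ 2)); lra.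
Qed.

Lemma slope_bounds t : 0 <= slope t <= 1 / 2.
Proof.
  destruct (Req_dec (wave 0 1 0 t) 0) as [E|E].
  - destruct (flat_slope 0) as [H _]; rewrite H by exact E; lra.
  - generalize (slope_pos t E); lra.
Qed.

Lemma slope_primitive :
  exists h : R -> R, h 0 = 0 /\ forall x, is_derive h x (slope x).
Proof.
  assert (C : forall x, continuous slope x).
  { intros x. destruct (flat_slope 1) as [_ [f' [Hd _]]].
    apply @ex_derive_continuous. exists (f' x); apply Hd. }
  exists (fun x => RInt slope 0 x); split; [apply @RInt_point|].
  intros x. apply (is_derive_RInt slope) with 0; [|apply C].
  apply filter_forall; intros b. apply @RInt_correct, @ex_RInt_continuous.
  intros z _; apply C.
Qed.

Theorem mainTheorem2 :
  exists (a b : Rbar) (h : R -> R),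
    in_open_interval a b 0 /\
    smooth_on a b h /\
    h 0 = 0 /\
    Rabs (Derive h 0) < 1 /\
    (exists y : R -> R, local_continuous_solution a b h y) /\
    (forall y : R -> R,
      local_continuous_solution a b h y ->
      ~ locally 0 (fun x : R => lagrange_formula_at h y x)).
Proof.
  destruct slope_primitive as [h [H0 Hd]].
  assert (Hincr := strictly_increasing_derive h slope Hd
    (fun x => proj1 (slope_bounds x))).
  exists m_infty, p_infty, h; repeat split.
  (* [n] derivatives of [slope] give [n + 1] derivatives of [h]; [flat_pred] drops the surplus
     one. *)
  - intros n x _. apply differentiable_ex_derive_n, flat_pred.
    split; [tauto|]. exists slope; split; [exact Hd|].
    exact (flat_differentiable _ _ _ (flat_slope n)).
  - exact H0.
  - rewrite (is_derive_unique _ _ _ (Hd 0)).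
    apply Rabs_def1; generalize (slope_bounds 0); lra.
  - destruct (continuous_fixpoint h slope H0 Hd (fun x => proj2 (slope_bounds x)))
      as [y [Hy0 Hy]].
    exists y; split; [exact Hy0|].
    apply filter_forall; intros x; destruct (Hy x); repeat split; auto.
  - intros y [_ Hy] HL.
    destruct (filter_and _ _ Hy HL) as [eps Heps].
    destruct (ex_wave_zero eps) as [x [Hx Hwx]].
    destruct (Heps x) as [[_ [_ Hyx]] HLx].
    { change (Rabs (x - 0) < eps). rewrite Rminus_0_r, Rabs_pos_eq; lra. }
    apply lagrange_formula_flat in HLx;
      [|intros m j; exact (Derive_n_pow_flat _ h slope Hd flat_slope m j x Hwx)].
    (* [slope] is positive off the zeros of the inner wave, and no interval consists of such
       zeros. *)
    assert (Hne : forall u v, u < v -> exists t, u < t < v /\ slope t <> 0).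
    { intros u v Huv; destruct (ex_wave_neq_0 u v Huv) as [t [Ht Hw]].
      exists t; split; [exact Ht|]. generalize (slope_pos t Hw); lra. }
    specialize (Hincr Hne).
    (* This is [h x > 0], which yields [x < x + h x] for the second use of monotonicity. *)
    assert (H1 := Hincr 0 x ltac:(lra)).
    assert (H2 := Hincr x (x + h x) ltac:(lra)).
    rewrite HLx in Hyx; lra.
Qed.
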